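(* Let $\mathcal{G}$ and $\mathcal{H}$ be DAGs on node set $[p]$. If $\{\mathcal{G},\mathcal{H}\}$ is an edge pair, then $\operatorname{conv}(c_{\mathcal{G}},c_{\mathcal{H}})$ is an edge of $\operatorname{CIM}_p$, where $p$ is the number of nodes in $\mathcal{G}$ and $\mathcal{H}$.
   Context: All graphs are simple and $[p]=\{1,\dots,p\}$. A DAG is a directed acyclic graph. For a DAG $\mathcal{G}$ let $\operatorname{pa}_{\mathcal{G}}(i)=\{k\colon k\to i\in\mathcal{G}\}$. Characteristic imset: for a DAG $\mathcal{G}$ on $[p]$, $c_{\mathcal{G}}\colon\{S\subseteq[p]\colon|S|\ge 2\}\to\{0,1\}$ is given by $c_{\mathcal{G}}(S)=1$ if there exists $i\in S$ such that $j\in\operatorname{pa}_{\mathcal{G}}(i)$ for all $j\in S\setminus\{i\}$, and $c_{\mathcal{G}}(S)=0$ otherwise. It is identified with a vector in $\mathbb{R}^{2^p-p-1}$ with standard basis vectors $e_S$ indexed by the sets $S\subseteq[p]$, $|S|\geq 2$. The characteristic imset polytope is $\operatorname{CIM}_p=\operatorname{conv}(c_{\mathcal{G}}\in\mathbb{R}^{2^p-p-1}\colon\mathcal{G}=([p],E)\text{ a DAG})$. Edge pair: let $\mathcal{G}$ and $\mathcal{H}$ be two DAGs on node set $[p]$. Suppose there exist distinct nodes $i$, $j$ and a set $S^\ast\subseteq[p]\setminus\{i,j\}$ such that (1) $c_{\mathcal{G}}(\{i,j\})=0$; (2) $c_{\mathcal{G}}(S\cup\{i\})=1$ for all $S\subseteq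 S^\ast$ with $|S|\ge1$. Then $\{\mathcal{G},\mathcal{H}\}$ is an edge pair (with respect to $(i,j,S^\ast)$) if $$c_{\mathcal{H}}=c_{\mathcal{G}}+\sum_{S\in\mathcal{S}_{+i\leftarrow j}}e_S,\qquad\text{where } \mathcal{S}_{+i\leftarrow j}=\{S\cup\{i,j\}\colon S\subseteq S^\ast\}.$$ An edge of a polytope is a one-dimensional face. *)

(* Defs.v *)
From HB Require Import structures.
From mathcomp Require Import all_boot all_order all_algebra.
From mathcomp Require Import boolp classical_sets reals convex.

Set Implicit Arguments.
Unset Strict Implicit.
Unset Printing Implicit Defensive.

Import Order.TTheory GRing.Theory Num.Theory.

Local Open Scope ring_scope.
Local Open Scope classical_set_scope.

Section Polytopes.
Variables (R : realType) (V : vectType R).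
Implicit Types A P F : set V.

Definition conv A : set V := smallest (@convex_set R V) A.

Definition affine_set A :=
  forall x y (t : R), A x -> A y -> A (t *: x + (1 - t) *: y).

Definition affine_hull A : set V := smallest affine_set A.

(* The affine hull of A is a translate of a d-dimensional linear subspace; in
   particular A is then nonempty. *)
Definition has_dim A (d : nat) :=
  exists (x0 : V) (U : {vspace V}),
    affine_hull A = [set x0 + u | u in [set` U]] /\ \dim U = d.

(* Faces are the sets of points where a valid linear inequality is tight (the
   zero functional gives P itself and the empty face). *)
Definition is_face P F :=
  exists (l : {linear V -> R^o}) (c : R),
    (forall x, P x -> l x <= c) /\ F = [set x | P x /\ l x = c].

Definition is_edge P F := is_face P F /\ has_dim F 1.

End Polytopes.

Section Imsets.
Variables (R : realType) (p : nat).

(* [e k i] is the arrow k -> i. A nonempty directed cycle is a nonempty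
   sequence x1, ..., xm with arrows x1 -> x2 -> ... -> xm -> x1. *)
Definition acyclic (e : rel 'I_p) := forall s : seq 'I_p, cycle e s -> s = [::].

Record dag := Dag { arrow :> rel 'I_p ; dag_acyclic : acyclic arrow }.

Definition pa (G : dag) (i : 'I_p) : {set 'I_p} := [set k | G k i]%SET.

(* Defined for all S; the characteristic imset is its restriction to the S with
   at least two elements, see [cim_vec]. *)
Definition cim (G : dag) (S : {set 'I_p}) : bool :=
  [exists i in S, [forall j in (S :\ i)%SET, j \in pa G i]].

Definition imset_index := {S : {set 'I_p} | (2 <= #|S|)%N}.

Definition imset_space := {ffun imset_index -> R^o}.

Definition cim_vec (G : dag) : imset_space := [ffun S => (cim G (val S))%:R].

Definition e_ (S : imset_index) : imset_space := [ffun T => (T == S)%:R].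

Definition CIM : set imset_space := conv (range cim_vec).

Definition S_plus (i j : 'I_p) (Sstar : {set 'I_p}) : {set {set 'I_p}} :=
  [set S :|: [set i; j] | S in powerset Sstar]%SET.

Definition edge_pair_wrt (G H : dag) (i j : 'I_p) (Sstar : {set 'I_p}) :=
  [/\ i != j,
      Sstar \subset (~: [set i; j])%SET,
      cim G [set i; j]%SET = false,
      forall S : {set 'I_p}, S \subset Sstar -> (1 <= #|S|)%N ->
        cim G (S :|: [set i])%SET = true
    & cim_vec H = cim_vec G + \sum_(T | val T \in S_plus i j Sstar) e_ T].

(* The pair {G, H} is unordered, whereas the defining equation is oriented from
   the smaller to the larger imset. *)
Definition edge_pair (G H : dag) :=
  exists (i j : 'I_p) (Sstar : {set 'I_p}),
    edge_pair_wrt G H i j Sstar \/ edge_pair_wrt H G i j Sstar.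

End Imsets.

Arguments cim_vec R {p} G.
Arguments CIM R p : clear implicits.
Arguments edge_pair R {p} G H.

(* Main.v *)
(* Let I = S_{+i<-j} and x_S = c_D(S + {i, j}) for S in Sstar.  Among the DAGs D
   that agree with G off I, the vector x is constant exactly for the imsets of G
   (x = 0) and H (x = 1).  On this class of DAGs some implications x_S -> x_T
   always hold, and acyclicity shows that every S is linked to the empty set by
   them.  Hence the functional that adds a large multiple of the agreement with
   G off I to the sum of x_S - x_T over all valid implications is maximal
   exactly at c_G and c_H. *)
From HB Require Import structures.
From mathcomp Require Import boolp convex interval_inference.
Require Import Defs.
From mathcomp Require Import all_boot all_order all_algebra.
From mathcomp Require Import classical_sets reals.

Set Implicit Arguments.
Unset Strict Implicit.
Unset Printing Implicit Defensive.

Import Order.TTheory GRing.Theory Num.Theory.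

Local Open Scope ring_scope.
Local Open Scope classical_set_scope.

(** * Convex hulls and edges exposed by a linear functional *)

Lemma convex_set_segment (R : realType) (V : vectType R) (A : set V) :
  (forall x y (t : R), A x -> A y -> 0 < t -> t < 1 ->
     A (t *: x + (1 - t) *: y)) ->
  @convex_set R V A.
Proof.
move=> cA; apply/convex_setW => x y /set_mem Ax /set_mem Ay k k0 k1.
exact/mem_set/cA.
Qed.

Lemma segment_convex_set (R : realType) (V : vectType R) (A : set V) x y t :
  @convex_set R V A -> A x -> A y -> 0 < t -> t < 1 ->
  A (t *: x + (1 - t) *: y).
Proof.
move=> cA Ax Ay t0 t1.
have := cA x y (Itv01 (ltW t0) (ltW t1)) (mem_set Ax) (mem_set Ay).
by move/set_mem.
Qed.

Lemma sub_conv (R : realType) (V : vectType R) (A : set V) : A `<=` conv A.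
Proof. exact: sub_gen_smallest. Qed.

Lemma convex_conv (R : realType) (V : vectType R) (A : set V) :
  @convex_set R V (conv A).
Proof.
apply: convex_set_segment => x y t Ax Ay t0 t1 B [cB sAB].
by apply: segment_convex_set => //; [apply: Ax|apply: Ay].
Qed.

Lemma conv_min (R : realType) (V : vectType R) (A B : set V) :
  @convex_set R V B -> A `<=` B -> conv A `<=` B.
Proof. by move=> cB sAB; apply: smallest_sub. Qed.

(** The affine hull is the line [u + <[v - u]>]: this line is affine and contains the segment, and
    its points are affine combinations of [u] and [v]. *)
Lemma has_dim_conv_pair (R : realType) (V : vectType R) (u v : V) :
  u != v -> has_dim (conv [set u; v]) 1.
Proof.
move=> uv; exists u, <[v - u]>%VS; split; last first.
  by rewrite dim_vline subr_eq0 eq_sym uv.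
have aff : affine_set [set u + w | w in [set` <[v - u]>%VS]].
  move=> _ _ t [x /= xU <-] [y /= yU <-].
  exists (t *: x + (1 - t) *: y); first by rewrite /= memvD ?memvZ.
  rewrite !scalerDr addrACA -scalerDl; congr (_ + _).
  by rewrite addrC subrK scale1r.
apply/seteqP; split.
  apply: smallest_sub => //; apply: conv_min.
    by apply: convex_set_segment => x y t Ax Ay _ _; apply: aff.
  move=> _ [->|->]; [exists 0 | exists (v - u)].
  - exact: mem0v.
  - by rewrite addr0.
  - exact: memv_line.
  - by rewrite addrC subrK.
move=> _ [_ /= /vlineP[t ->] <-] B [affB sB].
have -> : u + t *: (v - u) = t *: v + (1 - t) *: u.
  by rewrite scalerBr scalerBl scale1r addrCA.
by apply: affB; apply: sB; apply: sub_conv; [right|left].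
Qed.

(** The points strictly below the level [l u], together with the segment on that level, form a
    convex set containing [A]. It therefore contains [conv A], so the maximal face is no larger than
    the segment. *)
Lemma edge_of_two_maximizers (R : realType) (V : vectType R) (A : set V)
    (l : {linear V -> R^o}) (u v : V) :
  u != v -> A u -> A v -> l v = l u ->
  (forall x, A x -> [\/ x = u, x = v | l x < l u]) ->
  is_edge (conv A) (conv [set u; v]).
Proof.
move=> uv Au Av luv max; split; last exact: has_dim_conv_pair.
have lin x y (t : R) : l (t *: x + (1 - t) *: y) = t * l x + (1 - t) * l y.
  by rewrite linearD !linearZ.
exists l, (l u).
have bound : conv A `<=`
    [set x | l x < l u \/ l x = l u /\ conv [set u; v] x].
  apply: conv_min; last first.
    move=> x /max[-> | -> | lx]; [right|right|by left].
    - by split=> //; apply: sub_conv; left.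
    - by split=> //; apply: sub_conv; right.
  apply: convex_set_segment => x y t /= xP yP t0 t1.
  have s0 : 0 < 1 - t by rewrite subr_gt0.
  have lxP : l x <= l u by case: xP => [/ltW//|[->]].
  have lyP : l y <= l u by case: yP => [/ltW//|[->]].
  have lu : l u = t * l u + (1 - t) * l u by rewrite -mulrDl addrC subrK mul1r.
  rewrite lin; case: xP => [xl|[xl xC]].
    by left; rewrite lu ltr_leD ?ltr_pM2l// ler_pM2l.
  case: yP => [yl|[yl yC]].
    by left; rewrite lu ler_ltD ?ltr_pM2l// ler_pM2l.
  right; split; first by rewrite xl yl -lu.
  by apply: segment_convex_set => //; apply: convex_conv.
split.
  by move=> x /bound[/ltW//|[-> _]].
apply/seteqP; split.
  apply: conv_min; last first.
    by move=> x [->|->] /=; split=> //; apply: sub_conv.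
  apply: convex_set_segment => x y t [xC xl] [yC yl] t0 t1; split.
    by apply: segment_convex_set => //; apply: convex_conv.
  by rewrite lin xl yl -mulrDl addrC subrK mul1r.
move=> x [/bound[|[_ //]]] + lx; by rewrite lx ltxx.
Qed.

(** Abstract form of the argument: [P] marks the coordinates where [g] and [h] differ, and [r] holds
    implications valid for every [d] agreeing with [g] off [P]. *)
Lemma edge_of_implications (R : realType) (I : finType) (D : Type)
    (c : D -> I -> bool) (g h : D) (P : pred I) (r : rel I) (t0 : I) :
  P t0 ->
  (forall t, ~~ P t -> c h t = c g t) ->
  (forall t, P t -> c g t = false /\ c h t = true) ->
  (forall s t, r s t -> P s && P t) ->
  (forall d, (forall t, ~~ P t -> c d t = c g t) ->
     (forall s t, r s t -> c d s -> c d t) /\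
     ((forall s t, r s t -> c d s = c d t) ->
        forall t, P t -> c d t = c d t0)) ->
  let vec d : {ffun I -> R^o} := [ffun t => (c d t)%:R] in
  is_edge (conv (range vec)) (conv [set vec g; vec h]).
Proof.
move=> Pt0 ghN ghP rP dP vec.
(* [N] exceeds the number of implications, hence also [on] at every 0/1 vector, so one disagreement
   off [P] outweighs any gain in [on]. *)
pose N : R := #|[pred st : I * I | r st.1 st.2]|.+1%:R.
(* The signs favour [g]: at a 0/1 vector, each disagreement with [g] off [P] lowers [off] by exactly
   1. *)
pose off (v : {ffun I -> R^o}) : R :=
  \sum_(t | ~~ P t) (if c g t then v t else - v t).
(* At a 0/1 vector, an implication that holds contributes 0 if its two sides agree and -1
   otherwise. *)
pose on (v : {ffun I -> R^o}) : R :=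
  \sum_(st : I * I | r st.1 st.2) (v st.1 - v st.2).
pose l (v : {ffun I -> R^o}) : R^o := N * off v + on v.
have l_lin : linear l.
  move=> a u v; rewrite /l /on /off /GRing.scale/=.
  have -> : \sum_(t | ~~ P t)
      (if c g t then (a *: u + v) t else - (a *: u + v) t) =
      a * off u + off v.
    rewrite mulr_sumr -big_split; apply: eq_bigr => t _.
    by rewrite !ffunE; case: (c g t); rewrite ?opprD ?mulrN.
  have -> : \sum_(st : I * I | r st.1 st.2)
      ((a *: u + v) st.1 - (a *: u + v) st.2) = a * on u + on v.
    rewrite mulr_sumr -big_split; apply: eq_bigr => t _.
    by rewrite !ffunE mulrBr opprD addrACA.
  by rewrite !mulrDr addrACA mulrCA.
pose L : {linear {ffun I -> R^o} -> R^o} :=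
  HB.pack l (GRing.isLinear.Build _ _ _ _ l l_lin).
have vecE d t : vec d t = (c d t)%:R by rewrite ffunE.
have on0 d : (forall s t, r s t -> c d s = c d t) -> on (vec d) = 0.
  by move=> cd; rewrite /on big1// => st /cd; rewrite !vecE => ->; rewrite subrr.
have off_eq d d' : (forall t, ~~ P t -> c d t = c d' t) ->
    off (vec d) = off (vec d').
  by move=> dd'; apply: eq_bigr => t /dd'; rewrite !vecE => ->.
have on_const d b : (forall t, P t -> c d t = b) -> on (vec d) = 0.
  by move=> db; apply: on0 => s t /rP/andP[/db -> /db ->].
have on_g : on (vec g) = 0 by apply: (@on_const _ false) => t /ghP[].
have on_h : on (vec h) = 0 by apply: (@on_const _ true) => t /ghP[].
apply: (@edge_of_two_maximizers _ _ _ L) => /=.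
- apply/eqP => /ffunP/(_ t0); rewrite !vecE; case: (ghP _ Pt0) => -> -> /eqP.
  by rewrite eq_sym oner_eq0.
- by exists g.
- by exists h.
- by rewrite /l on_g on_h (off_eq _ _ ghN).
move=> _ [d _ <-].
have [dg|/existsNP[t /not_implyP[Pt ctN]]] :=
    pselect (forall t, ~~ P t -> c d t = c g t); last first.
  apply: Or33.
  have offD : off (vec d) <= off (vec g) - 1.
    rewrite /off (bigD1 t)//= [in leRHS](bigD1 t)//= addrAC lerD//.
      by rewrite !vecE; case: (c d t) (c g t) ctN => -[] // _;
        rewrite ?subrr ?oppr0 ?sub0r.
    apply: ler_sum => s _; rewrite !vecE.
    by do 2!case: (c _ s); rewrite ?oppr0 ?ler01 // lerNl oppr0.
  have onD : on (vec d) < N.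
    rewrite /N -natr1 ltr_pwDr// -sum1_card natr_sum; apply: ler_sum => st _.
    rewrite !vecE; do 2!case: (c d _); rewrite ?subrr ?subr0 ?sub0r ?ler01//.
    by rewrite lerNl (le_trans _ ler01)// oppr_le0.
  rewrite /l on_g addr0 -[ltRHS](subrK N) ler_ltD//.
  by rewrite -[X in _ - X]mulr1 -mulrBr ler_wpM2l.
have [impl eqv] := dP _ dg.
have [cd|/existsNP[s /existsNP[t /not_implyP[rst cst]]]] :=
    pselect (forall s t, r s t -> c d s = c d t).
  (* With all implications tight, [vec d] is constant on [P]; its value at [t0] decides between
     [vec g] and [vec h]. *)
  have vecd d' : (forall t, ~~ P t -> c d t = c d' t) ->
      (forall t, P t -> c d' t = c d t0) -> vec d = vec d'.
    move=> N' P'; apply/ffunP => t; rewrite !vecE.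
    by case: (boolP (P t)) => [Pt|/N' ->//]; rewrite P'// (eqv cd).
  case ct0 : (c d t0); [apply: Or32|apply: Or31]; apply: vecd => //.
  - by move=> t Pt; rewrite dg// ghN.
  - by move=> t /ghP[_ ->].
  - by move=> t /ghP[-> _].
(* Here [c d s] is false and [c d t] is true, so the term of [(s, t)] is -1, and no other term is
   positive. *)
apply: Or33; rewrite /l (off_eq d g)// ltrD2l on_g /on (bigD1 (s, t))//=.
rewrite -[ltRHS]addr0 ltr_leD//.
  rewrite !vecE; case: (c d s) (c d t) cst (impl _ _ rst) => -[] // _.
    by move=> /(_ isT).
  by rewrite sub0r oppr_lt0 ltr01.
rewrite sumr_le0// => -[s' t'] /andP[/= /impl ci _]; rewrite !vecE subr_le0.
by move: ci; do 2!case: (c d _) => //; rewrite ?ler01 // => /(_ isT).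
Qed.

(** * Sinks, adjacency and v-structures in characteristic imsets *)

Lemma cimP p (D : dag p) (S : {set 'I_p}) :
  reflect (exists2 k, k \in S & forall l, l \in S -> l != k -> D l k)
    (cim D S).
Proof.
apply: (iffP existsP) => [[k /andP[kS /forallP sink]]|[k kS sink]].
  exists k => // l lS lk; have := sink l.
  by rewrite !inE lk lS.
exists k; rewrite kS; apply/forallP => l; rewrite !inE.
by apply/implyP => /andP[lk lS]; apply: sink.
Qed.

Lemma dag_irr p (D : dag p) x : D x x = false.
Proof.
apply/negP => xx; have := @dag_acyclic p D [:: x].
by rewrite /= xx => /(_ isT).
Qed.

Lemma dag_asym p (D : dag p) x y : D x y -> D y x = false.
Proof.
move=> xy; apply/negP => yx; have := @dag_acyclic p D [:: x; y].
by rewrite /= xy yx => /(_ isT).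
Qed.

Lemma dag_no_3cycle p (D : dag p) x y z : D x y -> D y z -> D z x = false.
Proof.
move=> xy yz; apply/negP => zx; have := @dag_acyclic p D [:: x; y; z].
by rewrite /= xy yz zx => /(_ isT).
Qed.

Lemma dag_neq p (D : dag p) x y : D x y -> x != y.
Proof. by apply: contraTneq => ->; rewrite dag_irr. Qed.

(** Either element may be the sink, so the pairs record the skeleton. *)
Lemma cim_pair p (D : dag p) x y :
  x != y -> cim D [set x; y]%SET = D x y || D y x.
Proof.
move=> xy; apply/cimP/orP => [[k]|[a|a]].
- rewrite !inE => /orP[]/eqP-> sink; [right|left]; apply: sink => //.
  + by rewrite !inE eqxx orbT.
  + by rewrite eq_sym.
  + by rewrite !inE eqxx.
- exists y; rewrite ?inE ?eqxx ?orbT// => l.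
  by rewrite !inE => /orP[/eqP->//|->].
- exists x; rewrite ?inE ?eqxx// => l.
  by rewrite !inE => /orP[->//|/eqP->].
Qed.

(* If the sink k of T satisfies k -> j, then t -> k -> j forces t -> j for all
   t in T, so j is a sink of j |: T; otherwise k remains one. *)
Lemma cim_adjoin p (D : dag p) (T : {set 'I_p}) j :
  cim D T -> (forall t, t \in T -> t != j -> D t j || D j t) ->
  cim D (j |: T)%SET.
Proof.
move=> /cimP[k kT sink] adj; apply/cimP.
have [kj|kj] := boolP (D k j).
  exists j; rewrite ?setU11// => l; rewrite !inE => /orP[->//|lT lj].
  have [->//|lk] := eqVneq l k.
  case/orP: (adj l lT lj) => // jl.
  by rewrite (dag_no_3cycle (sink l lT lk) kj) in jl.
exists k; rewrite ?inE ?kT ?orbT// => l; rewrite !inE => /orP[/eqP->|].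
  move=> jk; have := adj k kT; rewrite eq_sym jk (negPf kj).
  exact.
exact: sink.
Qed.

(** A sink at [x] or [z] would make these two adjacent, so only [y] can be the sink: the triple
    detects the v-structure [x -> y <- z]. *)
Lemma cim_vstructure p (D : dag p) x y z :
  x != y -> z != y -> x != z -> cim D [set x; z]%SET = false ->
  cim D [set x; y; z]%SET = D x y && D z y.
Proof.
move=> xy zy xz; rewrite cim_pair// => /negbT/norP[Nxz Nzx].
apply/cimP/andP => [[k]|[xy' zy']].
  rewrite !inE -orbA => /or3P[]/eqP-> sink.
  - by move: Nzx; rewrite sink ?inE ?eqxx ?orbT// eq_sym.
  - by rewrite !sink ?inE ?eqxx ?orbT.
  - by move: Nxz; rewrite sink ?inE ?eqxx.
exists y; rewrite ?inE ?eqxx ?orbT// => l.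
by rewrite !inE -orbA => /or3P[]/eqP-> //; rewrite eqxx.
Qed.

(** If [i] or [j] were the sink, the other would point to it and the two would be adjacent. *)
Lemma cim_sink_or_adjacent p (D : dag p) (S : {set 'I_p}) i j :
  i != j -> cim D (S :|: [set i; j])%SET -> ~~ cim D [set i; j]%SET ->
  exists2 k, k \in S & D j k /\ forall b, b \in S -> b != k -> D b k.
Proof.
move=> ij /cimP[k]; rewrite cim_pair// !inE => kS sink /norP[Nij Nji].
have [ki|ki] := eqVneq k i.
  by move: Nji; rewrite -ki sink ?inE ?eqxx ?orbT// ki eq_sym.
have [kj|kj] := eqVneq k j.
  by move: Nij; rewrite -kj sink ?inE ?eqxx ?orbT// kj.
exists k; first by move: kS; rewrite (negPf ki) (negPf kj) !orbF.
split; first by rewrite sink ?inE ?eqxx ?orbT// eq_sym.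
by move=> b bS; apply: sink; rewrite inE bS.
Qed.

(* As b is not adjacent to j, the sink of {b, i, j} is i, so j -> i.  The sink m
   of S + i is i or adjacent to j (else m -> k), and j -> i -> m gives j -> m. *)
Lemma cim_adjoin_dominated p (D : dag p) (S : {set 'I_p}) i j b k :
  i \notin S -> j \notin S -> i != j ->
  cim D (S :|: [set i])%SET -> b \in S -> ~~ cim D [set b; j]%SET ->
  cim D ([set b] :|: [set i; j])%SET ->
  (forall m, m \in S -> ~~ cim D [set m; j]%SET -> D m k) ->
  k \in S -> cim D [set k; j]%SET ->
  cim D (S :|: [set i; j])%SET.
Proof.
move=> iS jS ij /cimP[m mS msink] bS.
have nj x : x \in S -> x != j by apply: contraTneq => ->.
have ni x : x \in S -> x != i by apply: contraTneq => ->.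
rewrite cim_pair ?nj// => /norP[Nbj Njb].
move=> /cimP[q]; rewrite !inE => qP qsink dom kS kj.
have {qP} qi : q = i.
  case/or3P: qP => /eqP qE //; subst q.
    by move: Njb; rewrite qsink ?inE ?eqxx ?orbT// eq_sym nj.
  by move: Nbj; rewrite qsink ?inE ?eqxx// nj.
rewrite {}qi in qsink.
have ji : D j i by rewrite qsink ?inE ?eqxx ?orbT// eq_sym.
apply/cimP; exists m.
  by move: mS; rewrite !inE => /orP[->//|->]; rewrite orbT.
move=> l; rewrite !inE => lP lm.
have [lj|lj] := eqVneq l j; last first.
  by apply: msink; rewrite ?inE//; move: lP; rewrite (negPf lj) orbF.
subst l; move: mS; rewrite !inE => /orP[mS|/eqP->//].
have im : D i m by rewrite msink ?inE ?eqxx ?orbT// eq_sym ni.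
have [|mj] := boolP (cim D [set m; j]%SET).
  by rewrite cim_pair ?nj// (dag_no_3cycle ji im).
have mk := dom _ mS mj.
have := msink k; rewrite inE kS => /(_ isT).
rewrite eq_sym (dag_neq mk) => /(_ isT) km.
by rewrite (dag_asym mk) in km.
Qed.

(** * Implications among the DAGs that agree with [G] off [I] *)

Definition agree_off p (I : {set {set 'I_p}}) (D G : dag p) :=
  forall T : {set 'I_p}, (2 <= #|T|)%N -> T \notin I -> cim D T = cim G T.

Lemma S_plusP p (i j : 'I_p) (Sstar T : {set 'I_p}) :
  reflect
    (exists2 S : {set 'I_p}, S \subset Sstar & T = (S :|: [set i; j])%SET)
    (T \in S_plus i j Sstar).
Proof.
apply: (iffP imsetP) => -[S sS ->]; exists S => //.
  by rewrite -powersetE.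
by rewrite powersetE.
Qed.

(** Every member of [S_plus i j Sstar] contains both [i] and [j]. *)
Lemma agree_S_plus p (D G : dag p) i j Sstar (T : {set 'I_p}) :
  agree_off (S_plus i j Sstar) D G -> (2 <= #|T|)%N ->
  ~~ [&& i \in T & j \in T] -> cim D T = cim G T.
Proof.
move=> DG T2 ijT; apply: DG => //; apply: contraNN ijT => /S_plusP[S _ ->].
by rewrite !inE !eqxx !orbT.
Qed.

Definition implication p (G : dag p) (I : {set {set 'I_p}}) S T :=
  forall D : dag p, agree_off I D G -> cim D S -> cim D T.

(** The case split uses only data of [G] that every [D] in the class shares. In the third
    alternative one [x_{b}] implies both [x_S] and the coordinate of the empty set, which links
    these two once all implications are equalities. *)
Lemma S_plus_connected p (G : dag p) i j (Sstar S : {set 'I_p}) :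
  let I := S_plus i j Sstar in
  i != j -> Sstar \subset (~: [set i; j])%SET ->
  (forall S' : {set 'I_p}, S' \subset Sstar -> cim G (S' :|: [set i])%SET) ->
  S \subset Sstar ->
  [\/ implication G I [set i; j]%SET (S :|: [set i; j])%SET,
      implication G I (S :|: [set i; j])%SET [set i; j]%SET |
      exists2 b, b \in S &
        implication G I ([set b] :|: [set i; j])%SET [set i; j]%SET /\
        implication G I ([set b] :|: [set i; j])%SET (S :|: [set i; j])%SET].
Proof.
move=> I ij Sij Gi sS.
have Si : {subset S <= [pred x | x != i & x != j]}.
  move=> x xS; have := fintype.subsetP Sij x (fintype.subsetP sS x xS).
  by rewrite !inE negb_or.
have ni x : x \in S -> x != i by move=> /Si/andP[].
have nj x : x \in S -> x != j by move=> /Si/andP[].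
have iS : i \notin S by apply/negP => /ni; rewrite eqxx.
have jS : j \notin S by apply/negP => /nj; rewrite eqxx.
(* The sets [{x, j}], [{x, y, j}] and [S + i] each miss [i] or [j], so [D] and [G] agree on them. *)
have agree_j (D : dag p) x : agree_off I D G -> x \in S ->
    cim D [set x; j]%SET = cim G [set x; j]%SET.
  move=> DG xS; apply: (agree_S_plus DG); first by rewrite cards2 nj.
  by rewrite !inE eq_sym (negPf (ni _ xS)) (negPf ij).
have agree_v (D : dag p) x y : agree_off I D G -> x \in S -> y \in S ->
    cim D [set x; y; j]%SET = cim G [set x; y; j]%SET.
  move=> DG xS yS; apply: (agree_S_plus DG).
    have sub : ([set x; j] \subset [set x; y; j])%SET.
      by rewrite finset.subUset !finset.sub1set !inE !eqxx !orbT.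
    by rewrite (leq_trans _ (subset_leq_card sub))// cards2 nj.
  rewrite !inE ![i == _]eq_sym (negPf (ni _ xS)) (negPf (ni _ yS)).
  by rewrite eq_sym (negPf ij).
have agree_i (D : dag p) : agree_off I D G -> S != finset.set0 ->
    cim D (S :|: [set i])%SET.
  move=> DG S0; rewrite (agree_S_plus DG) ?Gi//.
    by rewrite finset.setUC cardsU1 iS ltnS card_gt0.
  by rewrite !inE eqxx orbT/= (negPf jS) eq_sym.
have [adjS|] := boolP [forall s in S, cim G [set s; j]%SET].
  (* In [D], [j] is adjacent to [i] and to all of [S], so it can be adjoined to [S + i], which has a
     sink. *)
  apply: Or31 => D DG Dij.
  have [->|S0] := eqVneq S finset.set0; first by rewrite finset.set0U.
  have -> : (S :|: [set i; j] = j |: (S :|: [set i]))%SET.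
    by rewrite finset.setUA finset.setUC.
  apply: cim_adjoin; first exact: agree_i.
  move=> t; rewrite !inE => /orP[tS|/eqP-> _]; last by rewrite -cim_pair.
  move=> tj; rewrite -cim_pair// agree_j//.
  by move/forallP: adjS => /(_ t); rewrite tS.
rewrite negb_forall => /existsP[b]; rewrite negb_imply => /andP[bS bj].
(* Some k with v-structures b -> k <- j for all b not adjacent to j: not involving
   i, they are shared by all D that agree with G off I.  Such a k gives
   x_{b} -> x_S, and without one x_S forces i and j to be adjacent. *)
pose dominated := [exists k in S, cim G [set k; j]%SET &&
  [forall b in S, ~~ cim G [set b; j]%SET ==> cim G [set b; k; j]%SET]].
(* If [i] and [j] are not adjacent in [D], the sink [k] lies in [S'] and [j -> k]. The [b] supplied
   for [k] then gives a v-structure [b -> k <- j] in [D], which the shared value on [{b, k, j}]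
   excludes. *)
have toij (S' : {set 'I_p}) : S' \subset S ->
    (forall k, k \in S' -> cim G [set k; j]%SET ->
       exists2 b, b \in S' & ~~ cim G [set b; j]%SET /\
         ~~ cim G [set b; k; j]%SET) ->
    implication G I (S' :|: [set i; j])%SET [set i; j]%SET.
  move=> S'S nodom D DG xS'; have [//|Nij] := boolP (cim D [set i; j]%SET).
  have [k kS' [jk sink]] := cim_sink_or_adjacent ij xS' Nij.
  have kS := fintype.subsetP S'S _ kS'.
  have kj : cim G [set k; j]%SET.
    by rewrite -(agree_j D)// cim_pair ?nj// jk orbT.
  have [b' b'S' [b'j]] := nodom k kS' kj.
  have b'S := fintype.subsetP S'S _ b'S'.
  have b'k : b' != k by apply: contraNneq b'j => ->.
  rewrite -(agree_j D)// in b'j.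
  rewrite -(agree_v D)// cim_vstructure ?nj ?(negPf b'j) ?jk ?sink//.
  by rewrite eq_sym nj.
have [|] := boolP dominated.
  move=> /existsP[k /and3P[kS kj /forallP dom]].
  apply: Or33; exists b => //; split.
    apply: toij; first by rewrite finset.sub1set.
    (* For the singleton [{b}] the condition is vacuous, as [b] is not adjacent to [j]. *)
    by move=> x /finset.set1P ->; rewrite (negPf bj).
  move=> D DG xb; apply: (@cim_adjoin_dominated _ D S i j b k) => //.
  - apply: agree_i => //; by apply/set0Pn; exists b.
  - by rewrite agree_j.
  - move=> m mS mj; have := dom m; rewrite mS -(agree_j D)// mj -(agree_v D)//=.
    have mk : m != k by apply: contraNneq mj => ->; rewrite agree_j.
    rewrite cim_vstructure ?nj ?(negPf mj)// 1?eq_sym ?nj//.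
    by case/andP.
  - by rewrite agree_j.
rewrite negb_exists => /forallP ndom; apply: Or32; apply: toij => // k kS kj.
have := ndom k; rewrite kS kj/= negb_forall => /existsP[b'].
rewrite negb_imply => /andP[b'S]; rewrite negb_imply => /andP[b'j b'k].
by exists b'.
Qed.

(** * From edge pairs to edges of the polytope *)

Lemma edge_of_edge_pair_wrt (R : realType) p (G H : dag p) i j Sstar :
  edge_pair_wrt R G H i j Sstar ->
  is_edge (CIM R p) (conv [set cim_vec R G; cim_vec R H]).
Proof.
move=> [ij Sij Nij Gi cH].
set I := S_plus i j Sstar in cH.
(* Extends the condition to the empty [S]: [i] is trivially the sink of [{i}]. *)
have Gi' (S : {set 'I_p}) : S \subset Sstar -> cim G (S :|: [set i])%SET.
  have [->|S0] := eqVneq S finset.set0; last by move=> /Gi->//; rewrite card_gt0.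
  move=> _; apply/cimP; exists i; first by rewrite !inE eqxx orbT.
  by move=> l; rewrite !inE orFb => /eqP->; rewrite eqxx.
have card2 (S : {set 'I_p}) : (2 <= #|(S :|: [set i; j])%SET|)%N.
  by rewrite (leq_trans _ (subset_leq_card (finset.subsetUr S _)))// cards2 ij.
have card0 : (2 <= #|[set i; j]%SET|)%N by rewrite cards2 ij.
pose ix (S : {set 'I_p}) : imset_index p := Sub (S :|: [set i; j])%SET (card2 S).
pose t0 : imset_index p := Sub [set i; j]%SET card0.
have t0I : val t0 \in I.
  rewrite SubK; apply/S_plusP; exists finset.set0; rewrite ?finset.set0U//.
  exact: finset.sub0set.
have ixI (S : {set 'I_p}) : S \subset Sstar -> val (ix S) \in I.
  by move=> sS; rewrite SubK; apply/S_plusP; exists S.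
(* Coordinatewise, the added sum of basis vectors is the indicator of [I]. *)
have HG (t : imset_index p) :
    (cim H (val t))%:R = (cim G (val t))%:R + (val t \in I)%:R :> R.
  have /ffunP/(_ t) := cH; rewrite !ffunE => ->; congr (_ + _).
  rewrite sum_ffunE; have [tI|tI] := boolP (val t \in I).
    rewrite (bigD1 t)//= ffunE eqxx big1 ?addr0// => s /andP[_ st].
    by rewrite ffunE eq_sym (negPf st).
  rewrite big1// => s sI; rewrite ffunE; case: eqP => // ts.
  by rewrite ts sI in tI.
(* All valid implications inside [I], made boolean by classical logic. *)
pose r : rel (imset_index p) := fun s t =>
  [&& val s \in I, val t \in I & `[< implication G I (val s) (val t) >]].
apply: (@edge_of_implications R (imset_index p) (dag p)
  (fun D t => cim D (val t)) G H (fun t => val t \in I) r t0 t0I).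
- move=> t /negPf tI; have := HG t; rewrite tI addr0.
  case: (cim H _) (cim G _) => -[] // /eqP; first by rewrite oner_eq0.
  by rewrite eq_sym oner_eq0.
(* Two values in {0, 1} that differ by 1 must be 0 for [G] and 1 for [H]. *)
- move=> t tI; have := HG t; rewrite tI.
  case: (cim G _) (cim H _) => -[] // /eqP.
  + by rewrite -[X in X == _]addr0 (inj_eq (addrI _)) eq_sym oner_eq0.
  + by rewrite eq_sym (pnatr_eq0 R 2).
  + by rewrite add0r eq_sym oner_eq0.
- by move=> s t /and3P[-> ->].
move=> D DG; have DG' : agree_off I D G.
  by move=> T T2 TI; apply: (DG (Sub T T2)); rewrite SubK.
split; first by move=> s t /and3P[_ _ /asboolP]; apply.
move=> eqr t /[dup] tI /S_plusP[S sS tS].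
have {tS} -> : t = ix S by apply: val_inj.
have rI (s s' : imset_index p) : val s \in I -> val s' \in I ->
    implication G I (val s) (val s') -> cim D (val s) = cim D (val s').
  by move=> sI s'I ss'; apply: eqr; apply/and3P; split=> //; apply/asboolP.
(* Equality along implications carries the value at [ix S] to [t0], in the last case through [ix] of
   [{b}]. *)
case: (@S_plus_connected _ G i j Sstar S) => // [st|ts|[b bS [b0 bt]]].
- exact/esym/rI/st/ixI.
- exact/rI/ts/t0I/ixI.
- have bI : val (ix [set b]%SET) \in I.
    by apply/ixI; rewrite finset.sub1set (fintype.subsetP sS).
  rewrite -(rI (ix [set b]%SET) (ix S))//; last exact: ixI.
  exact: rI.
Qed.

Theorem theorem3p9 (R : realType) (p : nat) (G H : dag p) :
  edge_pair R G H ->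
  is_edge (CIM R p) (conv [set cim_vec R G; cim_vec R H]).
Proof.
move=> [i [j [Sstar []]]]; first exact: edge_of_edge_pair_wrt.
by rewrite setUC; apply: edge_of_edge_pair_wrt.
Qed.
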